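(* Let $\tilde A=(a;\,l^{\mu L},r^{\mu L},l^{\mu U},r^{\mu U};\,l^{\nu L},r^{\nu L},l^{\nu U},r^{\nu U})_{LR}$ be an $LR$-type IVIFN and let $\lambda\in\mathbb R$. Then $$\lambda\tilde A=\begin{cases}(\lambda a;\,\lambda l^{\mu L},\lambda r^{\mu L},\lambda l^{\mu U},\lambda r^{\mu U};\,\lambda l^{\nu L},\lambda r^{\nu L},\lambda l^{\nu U},\lambda r^{\nu U})_{LR}&\text{if }\lambda\ge0,\\[2pt](\lambda a;\,-\lambda r^{\mu L},-\lambda l^{\mu L},-\lambda r^{\mu U},-\lambda l^{\mu U};\,-\lambda r^{\nu L},-\lambda l^{\nu L},-\lambda r^{\nu U},-\lambda l^{\nu U})_{LR}&\text{if }\lambda<0.\end{cases}$$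
   Context: A shape function is a continuous, strictly decreasing, invertible $f:[0,\infty)\to[0,1]$ with $f(0)=1$ and $\lim_{x\to\infty}f(x)=0$. Fix shape functions $L,R,L',R'$. An $LR$-type interval-valued intuitionistic fuzzy number (IVIFN) is written $\tilde A=(a;l^{\mu L},r^{\mu L},l^{\mu U},r^{\mu U};l^{\nu L},r^{\nu L},l^{\nu U},r^{\nu U})_{LR}$, where $a\in\mathbb R$ is its mean value and the eight spreads are positive reals with $l^{\mu U}\ge l^{\mu L}$, $r^{\mu U}\ge r^{\mu L}$, $l^{\nu L}\ge l^{\nu U}$, $r^{\nu L}\ge r^{\nu U}$, $l^{\nu L}\ge l^{\mu L}$, $r^{\nu L}\ge r^{\mu L}$, $l^{\nu U}\ge l^{\mu U}$, $r^{\nu U}\ge r^{\mu U}$. It encodes a lower membership function equal to $L((a-x)/l^{\mu L})$ on $[a-l^{\mu L},a]$, $R((x-a)/r^{\mu L})$ on $[a,a+r^{\mu L}]$, and $0$ otherwise; an upper membership function of the same form with $L',R',l^{\mu U},r^{\mu U}$; a lower non-membership function equal to $1-L((a-x)/l^{\nu L})$ on $[a-l^{\nu L},a]$, $1-R((x-a)/r^{\nu L})$ on $[a,a+r^{\nu L}]$, and $1$ otherwise; and an upper non-membership function of the same form with $L',R',l^{\nu U},r^{\nu U}$. At each $x$ the supremum of the membership interval plus the supremum of the non-membership interval is at most $1$. Scalar multiplication is formed cutwise by interval arithmetic and read off at the level where the inverse shape functions equal $0$ (giving the mean) and at the level where they equal $1$ (giving the spreads). That is, $\lambda\tilde A$ (with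 the same shape functions) is the tuple with mean $\hat a=\lambda a$ and spreads $\hat l^{\kappa},\hat r^{\kappa}$ determined, for each $\kappa\in\{\mu L,\mu U,\nu L,\nu U\}$, by $$[\hat a-\hat l^{\kappa},\hat a+\hat r^{\kappa}]=\{\lambda x: x\in[a-l^{\kappa},a+r^{\kappa}]\}.$$ For $\lambda=0$ the tuple notation is used with all spreads equal to $0$. *)

(* Defs.v *)
From HB Require Import structures.
From mathcomp Require Import all_boot all_order all_algebra.
From mathcomp Require Import all_classical all_reals all_analysis.

Set Implicit Arguments.
Unset Strict Implicit.
Unset Printing Implicit Defensive.

Import Order.TTheory GRing.Theory Num.Theory.
Import numFieldNormedType.Exports.

Local Open Scope classical_set_scope.
Local Open Scope ring_scope.

(* A shape function lives on [0, +oo[; its values at negative reals are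
   irrelevant and left unconstrained.  Strict decrease towards 0 forces
   f > 0, so f is never onto [0, 1]: "invertible" can only mean invertible
   onto its range, which is what [shape_inj] says. *)
Record shape_function (K : realType) := ShapeFunction {
  shape_fun :> K -> K;
  shape_range : forall x, 0 <= x -> 0 <= shape_fun x <= 1;
  shape_continuous : {within `[0, +oo[, continuous shape_fun};
  shape_decreasing : forall x y, 0 <= x -> x < y -> shape_fun y < shape_fun x;
  shape_inj : set_inj `[0, +oo[ shape_fun;
  shape_at0 : shape_fun 0 = 1;
  shape_lim : shape_fun x @[x --> +oo] --> (0 : K)
}.

(* The bare tuple (a; l^muL, r^muL, l^muU, r^muU; l^nuL, r^nuL, l^nuU, r^nuU)
   written with respect to the shape functions L, R, L', R'.  No constraint is
   put on the spreads here, since the same notation is used with zero spreads;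
   see [is_ivifn]. *)
Record lr_tuple (K : realType) (L R L' R' : shape_function K) := LRTuple {
  mean : K;
  l_muL : K; r_muL : K; l_muU : K; r_muU : K;
  l_nuL : K; r_nuL : K; l_nuU : K; r_nuU : K
}.

Arguments LRTuple {K L R L' R'}.

Variant component := MuL | MuU | NuL | NuU.

Definition lspread (K : realType) (L R L' R' : shape_function K)
    (A : lr_tuple L R L' R') (k : component) : K :=
  match k with
  | MuL => l_muL A | MuU => l_muU A | NuL => l_nuL A | NuU => l_nuU A
  end.

Definition rspread (K : realType) (L R L' R' : shape_function K)
    (A : lr_tuple L R L' R') (k : component) : K :=
  match k with
  | MuL => r_muL A | MuU => r_muU A | NuL => r_nuL A | NuU => r_nuU A
  end.

(* Both closed branches contain x = a, where they agree since f 0 = g 0 = 1. *)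
Definition lr_profile (K : realType) (f g : shape_function K)
    (a l r x : K) : K :=
  if a - l <= x <= a then f ((a - x) / l)
  else if a <= x <= a + r then g ((x - a) / r)
  else 0.

Section MembershipFunctions.
Variables (K : realType) (L R L' R' : shape_function K).
Variable A : lr_tuple L R L' R'.

Definition lower_membership (x : K) : K :=
  lr_profile L R (mean A) (l_muL A) (r_muL A) x.

Definition upper_membership (x : K) : K :=
  lr_profile L' R' (mean A) (l_muU A) (r_muU A) x.

Definition lower_nonmembership (x : K) : K :=
  1 - lr_profile L R (mean A) (l_nuL A) (r_nuL A) x.

Definition upper_nonmembership (x : K) : K :=
  1 - lr_profile L' R' (mean A) (l_nuU A) (r_nuU A) x.

End MembershipFunctions.

(* In [ivifn_le1], the upper functions are the right endpoints, hence the
   suprema, of the membership and non-membership intervals at x. *)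
Record is_ivifn (K : realType) (L R L' R' : shape_function K)
    (A : lr_tuple L R L' R') : Prop := IsIVIFN {
  ivifn_l_gt0 : forall k, 0 < lspread A k;
  ivifn_r_gt0 : forall k, 0 < rspread A k;
  ivifn_l_mu : l_muL A <= l_muU A;
  ivifn_r_mu : r_muL A <= r_muU A;
  ivifn_l_nu : l_nuU A <= l_nuL A;
  ivifn_r_nu : r_nuU A <= r_nuL A;
  ivifn_l_lower : l_muL A <= l_nuL A;
  ivifn_r_lower : r_muL A <= r_nuL A;
  ivifn_l_upper : l_muU A <= l_nuU A;
  ivifn_r_upper : r_muU A <= r_nuU A;
  ivifn_le1 : forall x, upper_membership A x + upper_nonmembership A x <= 1
}.

(* [is_scalar_mul lam A B] : B is the scalar multiple of A by lam, for the same
   shape functions.  The spreads of B are characterized by the interval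
   equation, not given by a formula. *)
Definition is_scalar_mul (K : realType) (L R L' R' : shape_function K)
    (lam : K) (A B : lr_tuple L R L' R') : Prop :=
  mean B = lam * mean A /\
  forall k : component,
    `[mean B - lspread B k, mean B + rspread B k]%classic =
    [set lam * x | x in `[mean A - lspread A k, mean A + rspread A k]].

(* Main.v *)
Require Import Defs.
From mathcomp Require Import all_boot all_order all_algebra.
From mathcomp Require Import all_classical all_reals all_analysis.
From mathcomp Require Import ring lra.

Import Order.TTheory GRing.Theory Num.Theory.

Local Open Scope ring_scope.

(** Scaling by [lam] carries a nonempty closed interval onto the closed interval between the scaled
    endpoints, in the same order for [0 <= lam] and swapped for [lam < 0]. Since a nonempty closed
    interval determines its endpoints ([set_itvcc_inj]), cancelling the common mean [lam * mean A]
    turns each interval equation into two formulas for the spreads. The swap of endpoints is what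
    exchanges left and right spreads for negative [lam]. *)

(** Each endpoint of one interval lies in the other, so antisymmetry applies. Nonemptiness matters:
    all empty intervals are the same set. *)
Lemma set_itvcc_inj (K : realType) (a b c d : K) : a <= b ->
  (`[c, d] = `[a, b])%classic -> c = a /\ d = b.
Proof.
move=> ab E.
have mem x : (c <= x <= d) = (a <= x <= b).
  by apply/idP/idP => h;
    [have : `[a, b]%classic x by rewrite -E /= in_itv
    |have : `[c, d]%classic x by rewrite E /= in_itv]; rewrite /= in_itv.
have /andP[ca ad] : c <= a <= d by rewrite mem lexx.
have /andP[cb bd] : c <= b <= d by rewrite mem lexx ab.
have /andP[ac _] : a <= c <= b by rewrite -mem lexx (le_trans ca).
have /andP[_ db] : a <= d <= b by rewrite -mem lexx (le_trans ca).
by split; apply/le_anti/andP.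
Qed.

Lemma image_itvcc_scale_ge0 (K : realType) (lam a b : K) : a <= b -> 0 <= lam ->
  [set lam * x | x in `[a, b]]%classic = `[lam * a, lam * b]%classic.
Proof.
move=> ab; rewrite le_eqVlt => /predU1P[<-|lam0]; apply/seteqP; split=> y /=.
- by move=> [x _ <-]; rewrite in_itv /= !mul0r lexx.
- rewrite in_itv /= !mul0r -eq_le => /eqP <-.
  (* At [lam = 0] the target is the single point 0, and [a <= b] supplies [a] as a preimage. *)
  by exists a; rewrite ?mul0r //= in_itv /= lexx.
- by move=> [x + <-]; rewrite !in_itv /= !ler_pM2l.
- rewrite in_itv /= => /andP[ay yb]; exists (y / lam); last by field; lra.
  by rewrite /= in_itv /= ler_pdivlMr // ler_pdivrMr // ![_ * lam]mulrC ay.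
Qed.

Lemma image_itvcc_scale_lt0 (K : realType) (lam a b : K) : lam < 0 ->
  [set lam * x | x in `[a, b]]%classic = `[lam * b, lam * a]%classic.
Proof.
move=> lam0; apply/seteqP; split=> y /=.
  by move=> [x + <-]; rewrite !in_itv /= !ler_nM2l // andbC.
rewrite in_itv /= => /andP[by_ ya]; exists (y / lam); last by field; lra.
by rewrite /= in_itv /= ler_ndivlMr // ler_ndivrMr // ![_ * lam]mulrC ya.
Qed.

(** Keeping the component [k] generic lets one sign analysis solve all four interval equations;
    positive spreads make the intervals nonempty. *)
Lemma is_scalar_mulP (K : realType) (L R L' R' : shape_function K)
    (A : lr_tuple L R L' R') (hA : is_ivifn A) (lam : K)
    (B : lr_tuple L R L' R') :
  is_scalar_mul lam A B <->
  mean B = lam * mean A /\ forall k,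
    lspread B k = (if 0 <= lam then lam * lspread A k else - lam * rspread A k) /\
    rspread B k = (if 0 <= lam then lam * rspread A k else - lam * lspread A k).
Proof.
have nonempty k : mean A - lspread A k <= mean A + rspread A k.
  have := ivifn_l_gt0 hA k; have := ivifn_r_gt0 hA k; lra.
split=> -[mB sB]; split=> // k; move: (sB k) (nonempty k) => {sB}; rewrite mB;
  case: (leP 0 lam) => lam0.
- move=> + ab; rewrite image_itvcc_scale_ge0 // => E.
  have [] := set_itvcc_inj _ _ _ _ _ (ler_wpM2l lam0 ab) E.
  by rewrite mulrBr mulrDr => ? ?; split; lra.
- move=> + ab; rewrite image_itvcc_scale_lt0 // => E.
  (* The left endpoint for [B] is now [lam] times the right endpoint for [A]. *)
  have [] := set_itvcc_inj _ _ _ _ _ (ler_wnM2l (ltW lam0) ab) E.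
  by rewrite mulrBr mulrDr => ? ?; split; lra.
- by move=> [-> ->] ab; rewrite image_itvcc_scale_ge0 // mulrBr mulrDr.
- by move=> [-> ->] ab; rewrite image_itvcc_scale_lt0 // mulrBr mulrDr !mulNr opprK.
Qed.

Theorem proposition3p1p2 (K : realType) (L R L' R' : shape_function K)
    (A : lr_tuple L R L' R') (hA : is_ivifn A) (lam : K)
    (B : lr_tuple L R L' R') :
  is_scalar_mul lam A B <->
  B = if 0 <= lam then
        LRTuple (lam * mean A)
          (lam * l_muL A) (lam * r_muL A) (lam * l_muU A) (lam * r_muU A)
          (lam * l_nuL A) (lam * r_nuL A) (lam * l_nuU A) (lam * r_nuU A)
      else
        LRTuple (lam * mean A)
          (- lam * r_muL A) (- lam * l_muL A) (- lam * r_muU A) (- lam * l_muU A)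
          (- lam * r_nuL A) (- lam * l_nuL A) (- lam * r_nuU A) (- lam * l_nuU A).
Proof.
rewrite (is_scalar_mulP _ _ _ _ _ _ hA); split; last first.
  by move=> ->; case: ifP => _; split=> // -[].
(* Equality of tuples needs all nine fields: the mean, and two spreads from each instance of [sB].
   Their conditionals share one test, so a single case split finishes. *)
case: B => m a b c d e f g h /= [-> sB].
case: (sB MuL) (sB MuU) (sB NuL) (sB NuU) => /= -> -> [-> ->] [-> ->] [-> ->].
by case: ifP.
Qed.
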